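(* Let $M$ be an $N$-function and let $\phi:(0,1]\to(0,\infty)$ be a positive function such that $$M(\lambda u)\ \ge\ \phi(\lambda)\, M(u)\qquad\text{for all } 0<\lambda\le 1 \text{ and all } u\ge 0.$$ Then for every $x\in L_M$ with $0<\|x\|\le 1$, $$\mathcal{M}(x)\ \ge\ \phi(\|x\|).$$
   Context: $(\Omega,\mathfrak{A},\mu)$ is a set with a $\sigma$-algebra and a $\sigma$-additive measure $\mu$ that is finite ($\mu(\Omega)<\infty$) and continuous (every set of positive measure can be divided into two sets of equal measure). An $N$-function is a convex function $M:[0,\infty)\to[0,\infty)$ with $\lim_{u\to0}M(u)/u=0$ and $\lim_{u\to\infty}M(u)/u=\infty$. The modular generated by $M$ is $\mathcal{M}(x)=\int_\Omega M(|x(\omega)|)\,d\mu(\omega)\in[0,\infty]$ for measurable $x$ on $\Omega$. The Orlicz space $L_M$ is the set of measurable functions $x$ for which $\mathcal{M}(x/\lambda)<\infty$ for some $\lambda>0$. The norm $\|\cdot\|$ is the Luxemburg norm $\|x\|=\inf\{\lambda>0:\ \mathcal{M}(x/\lambda)\le 1\}$. *)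

(* Defs.v *)
From HB Require Import structures.
From mathcomp Require Import all_boot all_order all_algebra.
From mathcomp Require Import all_classical all_reals all_analysis.
Import Order.TTheory GRing.Theory Num.Theory.
Import numFieldNormedType.Exports.

Set Implicit Arguments.
Unset Strict Implicit.
Unset Printing Implicit Defensive.

Local Open Scope classical_set_scope.
Local Open Scope ring_scope.

(* An N-function is a map [0, +oo) -> [0, +oo); it is encoded as a total
   [M : R -> R] of which only the values on [0, +oo) are constrained, or used:
   below, [M] is only ever evaluated at nonnegative reals. *)
Definition N_function (R : realType) (M : R -> R) : Prop :=
  [/\ forall u : R, 0 <= u -> 0 <= M u,
      convex_function (`[0, +oo[ : set R) M,
      M u / u @[u --> (0 : R)^'+] --> (0 : R)
    & M u / u @[u --> +oo] --> +oo].

(* "Continuous" is not a topological condition: it says that every set of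
   positive measure splits into two sets of equal measure. *)
Definition continuous_measure (d : measure_display) (T : measurableType d)
    (R : realType) (mu : {measure set T -> \bar R}) : Prop :=
  forall A : set T, measurable A -> (0 < mu A)%E ->
    exists B : set T,
      [/\ measurable B, B `<=` A & mu B = mu (A `\` B)].

Definition modular (d : measure_display) (T : measurableType d)
    (R : realType) (mu : {measure set T -> \bar R}) (M : R -> R)
    (x : T -> R) : \bar R :=
  (\int[mu]_w (M `|x w|)%:E)%E.

Definition Orlicz_space (d : measure_display) (T : measurableType d)
    (R : realType) (mu : {measure set T -> \bar R}) (M : R -> R) :
    set (T -> R) :=
  [set x : T -> R | measurable_fun [set: T] x /\
    exists2 l : R, 0 < l & (modular mu M (fun w => x w / l)%R < +oo)%E].

(* The infimum is the one of [R], which is [0] on the empty set; hence a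
   positive Luxemburg norm implies that the set below is nonempty. *)
Definition Luxemburg_norm (d : measure_display) (T : measurableType d)
    (R : realType) (mu : {measure set T -> \bar R}) (M : R -> R)
    (x : T -> R) : R :=
  inf [set l : R | 0 < l /\ (modular mu M (fun w => x w / l)%R <= 1)%E].

(* Main.v *)
Require Import Defs.
From HB Require Import structures.
From mathcomp Require Import all_boot all_order all_algebra.
From mathcomp Require Import all_classical all_reals all_analysis.
From mathcomp Require Import measurable_realfun ring lra.
Import Order.TTheory GRing.Theory Num.Theory.
Import numFieldNormedType.Exports.

Local Open Scope classical_set_scope.
Local Open Scope ring_scope.

(** The theorem rests on the fact that a normalised function has modular at
    least one: with r the norm of x, the modular of x / r is at least 1.  Once
    this is known, the hypothesis on phi with l = r and u = |x w| / r reads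
    phi r * M (|x w| / r) <= M |x w|, and integrating it gives
    phi r <= phi r * modular (x / r) <= modular x.

    For a general N-function the modular of x / r can be smaller than 1, since
    the modular may jump to infinity as soon as x / r is dilated by a factor
    above 1.  The hypothesis on phi excludes this: l = 1/2 gives the doubling
    bound M (2 u) <= K * M u
    with K = (phi (1/2))^-1.  Convexity between u and 2 u turns it into
    M ((1 + e) u) <= (1 + e K) * M u for 0 <= e <= 1, so that dilating x / r by
    1 + e multiplies its modular by at most 1 + e K
    ([convex_doubling_dilation]).  As r is an infimum, x / (r / (1 + e)) has
    modular greater than 1 for every e > 0; letting e tend to 0 gives the claim
    ([modular_normalized_ge1]).

    This linear bound replaces any convergence theorem for integrals.  The
    measurability of the integrands comes from convexity too: the sublevel sets
    of a convex function are intervals ([convex_function_measurable]). *)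

Lemma convex_function_le {R : realType} {D : set R} {f : R -> R} {t a b : R} :
  convex_function D f -> D a -> D b -> 0 <= t <= 1 ->
  f (t * a + (1 - t) * b) <= t * f a + (1 - t) * f b.
Proof.
move=> cf Da Db /andP[t0 t1].
exact: (cf (Itv01 t0 t1) a b (mem_set Da) (mem_set Db)).
Qed.

(** The strict sublevel sets of [f] are intervals, and rays generate the Borel
    sets.  A convex function may jump at an endpoint of [D], which is why the
    argument does not go through continuity. *)
Lemma convex_function_measurable (R : realType) (D : set R) (f : R -> R) :
  is_interval D -> convex_function D f -> measurable_fun D f.
Proof.
move=> iD cf _; apply: (measurability _ (RGenInftyO.measurableE R)).
  move=> /= _ [_ [c ->] <-]; apply: is_interval_measurable => s t /=.
  rewrite !in_itv/= => -[Ds fs] [Dt ft] u /andP[su ut].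
  split; first by apply: (iD s t) => //; rewrite su ut.
  rewrite in_itv/=; have [st|ts] := ltP s t; last first.
    by have <- : s = u by apply/eqP; rewrite eq_le su (le_trans ut ts).
  have ts0 : 0 < t - s by rewrite subr_gt0.
  have k01 : 0 <= (t - u) / (t - s) <= 1.
    by rewrite divr_ge0 ?subr_ge0 ?(ltW st)//= ler_pdivrMr// mul1r lerD2l lerN2.
  set k := (t - u) / (t - s) in k01.
  have -> : u = k * s + (1 - k) * t by rewrite /k; field; rewrite gt_eqF.
  apply: le_lt_trans (convex_function_le cf Ds Dt k01) _.
  have /andP[k0 k1] := k01.
  by move: k0; rewrite le_eqVlt => /predU1P[<-|k0]; nra.
exact: is_interval_measurable.
Qed.

(** (1 + e) u is the barycentre of u and 2 u with weights 1 - e and e. *)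
Lemma convex_doubling_dilation {R : realType} {M : R -> R} {K e u : R} :
  convex_function (`[0, +oo[ : set R) M ->
  (forall v, 0 <= v -> 0 <= M v) ->
  (forall v, 0 <= v -> M (2 * v) <= K * M v) ->
  0 <= e <= 1 -> 0 <= u -> M ((1 + e) * u) <= (1 + e * K) * M u.
Proof.
move=> cM M0 M2 /andP[e0 e1] u0.
have := @convex_function_le _ _ _ (1 - e) u (2 * u) cM.
rewrite /= !in_itv/= !andbT; have -> : 0 <= 1 - e <= 1 by lra.
have -> : (1 - e) * u + (1 - (1 - e)) * (2 * u) = (1 + e) * u by ring.
move=> /(_ u0 (mulr_ge0 (ler0n _ 2) u0) isT).
by have := M2 u u0; have := M0 u u0; nra.
Qed.

Section modular.
Context {d : measure_display} {T : measurableType d} {R : realType}.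
Context (mu : {measure set T -> \bar R}) {M : R -> R}.
Hypothesis cM : convex_function (`[0, +oo[ : set R) M.
Hypothesis M0 : forall u, 0 <= u -> 0 <= M u.

Lemma measurable_modular_integrand (x : T -> R) :
  measurable_fun [set: T] x ->
  measurable_fun [set: T] (fun w => (M `|x w|)%:E).
Proof.
move=> mx; apply/measurable_EFinP.
apply: (@measurable_comp _ _ _ _ _ _ (`[0, +oo[ : set R) M) => //.
- by move=> _ [w _ <-] /=; rewrite in_itv/= normr_ge0.
- by apply: convex_function_measurable => //; exact: interval_is_interval.
- by apply: measurableT_comp.
Qed.

Lemma modular_ge0 (x : T -> R) : (0 <= modular mu M x)%E.
Proof. by apply: integral_ge0 => w _; rewrite lee_fin M0. Qed.

Lemma le_modularM {c : R} {x y : T -> R} : 0 <= c ->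
  measurable_fun [set: T] x -> measurable_fun [set: T] y ->
  (forall w, c * M `|x w| <= M `|y w|) ->
  (c%:E * modular mu M x <= modular mu M y)%E.
Proof.
move=> c0 mx my cxy; rewrite /modular -ge0_integralZl_EFin//; last 2 first.
- by move=> w _; rewrite lee_fin M0.
- exact: measurable_modular_integrand.
apply: ge0_le_integral => //.
- by move=> w _; rewrite -EFinM lee_fin mulr_ge0// M0.
- by apply: measurable_funeM; exact: measurable_modular_integrand.
- exact: measurable_modular_integrand.
- by move=> w _; rewrite -EFinM lee_fin.
Qed.

Lemma Luxemburg_norm_lt_modular {x : T -> R} {l : R} :
  0 < l < Luxemburg_norm mu M x -> (1 < modular mu M (fun w => (x w / l)%R))%E.
Proof.
move=> /andP[l0 lx]; rewrite ltNge; apply/negP => xl1.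
move: lx; rewrite ltNge => /negP; apply; apply: ge_inf => //.
by exists 0 => y [/ltW y0 _].
Qed.

(** Under the doubling bound the unit level of the modular cannot be skipped:
    dilation by 1 + e changes the modular by a factor that tends to 1. *)
Lemma modular_normalized_ge1 {K : R} {x : T -> R} :
  0 <= K -> (forall u, 0 <= u -> M (2 * u) <= K * M u) ->
  measurable_fun [set: T] x -> 0 < Luxemburg_norm mu M x ->
  (1 <= modular mu M (fun w => (x w / Luxemburg_norm mu M x)%R))%E.
Proof.
set r := Luxemburg_norm mu M x => K0 M2 mx r0.
have mdiv l : measurable_fun [set: T] (fun w => x w / l).
  exact: measurable_funM.
rewrite leNgt; apply/negP => xr1.
have := modular_ge0 (fun w => x w / r).
case mE : (modular mu M _) xr1 => [m| |] //; rewrite lte_fin lee_fin => m1 m0.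
(* This e is at most 1, and (1 + e * K) * m <= m + e * K <= 1. *)
pose e := (1 - m) / (1 + K).
have eE : e * (1 + K) = 1 - m by rewrite /e divfK// gt_eqF// ltr_pwDl.
have e0 : 0 < e by rewrite divr_gt0 ?subr_gt0// ltr_pwDl.
have e1 : e <= 1 by nra.
have eK0 : 0 < 1 + e * K by rewrite ltr_pwDl// mulr_ge0// ltW.
have le_re : 0 < r / (1 + e) < r.
  rewrite divr_gt0 ?addr_gt0//= ltr_pdivrMr ?addr_gt0//.
  by rewrite ltr_pMr// ltrDl.
have := Luxemburg_norm_lt_modular le_re; apply/negP; rewrite -leNgt.
have : ((1 + e * K)^-1%R%:E * modular mu M (fun w => (x w / (r / (1 + e)))%R)
        <= m%:E)%E.
  rewrite -mE; apply: le_modularM => //; first by rewrite invr_ge0 ltW.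
  move=> w; rewrite ler_pdivrMl//.
  have -> : `|x w / (r / (1 + e))| = (1 + e) * `|x w / r|.
    rewrite -[in RHS](gtr0_norm (_ : 0 < 1 + e)) ?addr_gt0// -normrM.
    by congr `|_|; field; rewrite !gt_eqF// addr_gt0.
  by apply: convex_doubling_dilation => //; rewrite (ltW e0).
rewrite lee_pdivrMl// -EFinM => /le_trans; apply.
by rewrite lee_fin; nra.
Qed.

End modular.

Theorem theorem3 (d : measure_display) (T : measurableType d) (R : realType)
    (mu : {finite_measure set T -> \bar R})
    (mu_cont : continuous_measure mu)
    (M : R -> R) (M_N : N_function M)
    (phi : R -> R)
    (phi_gt0 : forall l : R, 0 < l <= 1 -> 0 < phi l)
    (M_phi : forall l u : R, 0 < l <= 1 -> 0 <= u -> phi l * M u <= M (l * u))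
    (x : T -> R) (x_LM : x \in Orlicz_space mu M)
    (x_norm : 0 < Luxemburg_norm mu M x <= 1) :
  ((phi (Luxemburg_norm mu M x))%:E <= modular mu M x)%E.
Proof.
have [M0 cM _ _] := M_N; have [mx _] := set_mem x_LM.
set r := Luxemburg_norm mu M x in x_norm *.
have [r0 _] := andP x_norm.
have half01 : (0 : R) < 2^-1 <= (1 : R) by apply/andP; split; lra.
have doubling u : 0 <= u -> M (2 * u) <= (phi 2^-1)^-1 * M u.
  move=> u0; rewrite ler_pdivlMl ?phi_gt0//.
  have -> : M u = M (2^-1 * (2 * u)) by rewrite mulKf.
  by apply: M_phi => //; exact: mulr_ge0.
have K0 : 0 <= (phi 2^-1)^-1 by rewrite invr_ge0 ltW ?phi_gt0.
have xr1 := modular_normalized_ge1 mu cM M0 K0 doubling mx r0.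
have phir0 : 0 < phi r := phi_gt0 r x_norm.
apply: (@le_trans _ _ ((phi r)%:E * modular mu M (fun w => (x w / r)%R))%E).
  by rewrite -[leLHS]mule1; apply: lee_pmul; rewrite ?lee_fin// ltW.
apply: le_modularM => //; [exact: ltW|exact: measurable_funM|].
move=> w; have -> : `|x w| = r * `|x w / r|.
  by rewrite normrM normfV (gtr0_norm r0) mulrC divfK// gt_eqF.
exact: M_phi.
Qed.
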